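(* Let $n\ge1$ and $c\ge1$ be integers. For $0\le k\le (c-1)n+c\binom{n}{2}$, $$i_c(n,k)=\sum_{j=0}^{k} i(n,j)\,p_{\le n,c-1}(k-j).$$
   Context: For integers $n\ge1$, $c\ge1$, let $G_{c,n}$ be the set of colored permutations: words $\sigma=\sigma_1^{[c_1]}\cdots\sigma_n^{[c_n]}$ where $|\sigma|=\sigma_1\cdots\sigma_n$ is a permutation of $[n]$ and each color $c_i\in\{0,\dots,c-1\}$. For a permutation $\pi$ of $[n]$, $\mathrm{inv}(\pi)=|\{(i,j):i<j,\ \pi_i>\pi_j\}|$. Let $\mathrm{col}(\sigma)=c_1+\cdots+c_n$ and $\mathrm{inv}_c(\sigma)=\mathrm{inv}(|\sigma|)+\mathrm{col}(\sigma)+c\cdot|\{(i,j):1\le i<j\le n,\ \sigma_i<\sigma_j,\ c_j\ne0\}|$. Define $i_c(n,k)=|\{\sigma\in G_{c,n}:\mathrm{inv}_c(\sigma)=k\}|$, and let $i(n,k)$ be the number of permutations of $[n]$ with exactly $k$ inversions (classical Mahonian numbers). $p_{\le i,j}(m)$ denotes the number of integer partitions of $m$ into parts of size at most $i$ in which each part appears at most $j$ times. *)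

(* Defs.v *)
From mathcomp Require Import all_boot all_fingroup.

Set Implicit Arguments.
Unset Strict Implicit.
Unset Printing Implicit Defensive.

Definition inv n (pi : 'S_n) : nat :=
  #|[set p : 'I_n * 'I_n | (p.1 < p.2) && (pi p.1 > pi p.2)]|.

(* The word sigma_1^[c_1] ... sigma_n^[c_n] is the pair of the underlying      *)
(* permutation |sigma| and the color function i |-> c_i. Positions and values *)
(* range over {0, ..., n-1} instead of {1, ..., n}: only their order matters. *)
Definition colored_perm (c n : nat) : finType :=
  ('S_n * {ffun 'I_n -> 'I_c})%type.

Definition col c n (sigma : colored_perm c n) : nat :=
  \sum_(i < n) sigma.2 i.

(* In sigma_i < sigma_j only the underlying values are compared. *)
Definition inv_c c n (sigma : colored_perm c n) : nat :=
  inv sigma.1 + col sigma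
  + c * #|[set p : 'I_n * 'I_n |
           [&& p.1 < p.2, sigma.1 p.1 < sigma.1 p.2
             & sigma.2 p.2 != 0 :> nat]]|.

Definition mahonian (n k : nat) : nat :=
  #|[set pi : 'S_n | inv pi == k]|.

Definition colored_mahonian (c n k : nat) : nat :=
  #|[set sigma : colored_perm c n | inv_c sigma == k]|.

Definition is_partition (m : nat) (l : seq nat) : bool :=
  [&& sorted geq l, all (leq 1) l & sumn l == m].

(* A partition of m has at most m parts, all at most m, so that the finite    *)
(* type m.-bseq 'I_m.+1 contains every partition of m: see partition_bseq.    *)
Definition restricted_partitions (i j m : nat) : nat :=
  #|[set s : m.-bseq 'I_m.+1 |
     let l := map val s in
     [&& is_partition m l, all (geq i) l
       & all (fun x => count_mem x l <= j) l]]|.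

Lemma partition_bseq m l :
  is_partition m l -> exists s : m.-bseq 'I_m.+1, map val s = l.
Proof.
case/and3P=> _ l_gt0 /eqP suml.
have size_l : size l <= m.
  rewrite -suml; elim: l l_gt0 {suml} => //= x l IHl /andP[x_gt0 /IHl].
  by rewrite -add1n; apply: leq_add.
have le_l : all (geq m) l.
  apply/allP=> x /= lx; rewrite -suml {suml size_l l_gt0}.
  elim: l lx => //= y l IHl; rewrite inE => /predU1P[->|/IHl le_x].
    exact: leq_addr.
  by rewrite (leq_trans le_x) ?leq_addl.
have size_s : size (map (@inord m) l) <= m by rewrite size_map.
exists (Bseq size_s); rewrite /= -map_comp map_id_in // => x /(allP le_l) le_x.
by rewrite /= inordK.
Qed.

(* Main.v *)
Require Import Defs.
From mathcomp Require Import all_boot all_fingroup.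
From mathcomp Require Import ssralg poly zify.

(** The generating polynomial of inv_c over G_{c,n} factors position by
    position. If a_j counts the earlier smaller entries at position j (from 0),
    then inv is the sum of the j - a_j, and the a_j range independently over
    {0, ..., j}. The pair (a_j, c_j) contributes the exponent
    j - a_j + c_j + c a_j [c_j != 0], which takes each value in
    {0, ..., c (j + 1) - 1} exactly once. Hence the generating polynomial is the
    product over j <= n of [c j]_q = [j]_q (1 + q^j + ... + q^(j (c - 1))): the
    factors [j]_q are the case c = 1, and the remaining ones generate the
    partitions into parts at most n, each repeated at most c - 1 times. *)

Set Implicit Arguments.
Unset Strict Implicit.
Unset Printing Implicit Defensive.

Import GRing.Theory.

(** * Counting by coefficients, and q-integers *)

Lemma coef_sum_Xn (T : finType) (f : T -> nat) k :
  ((\sum_(x : T) 'X^(f x) : {poly nat})%R`_k)%R = #|[set x | f x == k]|.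
Proof.
rewrite coef_sum -sum1dep_card [RHS]big_mkcond /=.
by apply: eq_bigr => x _; rewrite coefXn eq_sym; case: eqP.
Qed.

Definition qint (m : nat) : {poly nat} := (\sum_(i < m) 'X^i)%R.

Lemma qintD m p : (qint (m + p) = qint m + 'X^m * qint p)%R.
Proof.
rewrite /qint big_split_ord /= mulr_sumr; congr (_ + _)%R.
by apply: eq_bigr => i _; rewrite exprD.
Qed.

(** Each exponent below [m * p] is uniquely r + m b with r < m and b < p. *)
Lemma qintM m p : (qint (m * p) = qint m * \sum_(b < p) 'X^(m * b))%R.
Proof.
elim: p => [|p IHp]; first by rewrite muln0 big_ord0 mulr0 /qint big_ord0.
by rewrite mulnSr qintD IHp big_ord_recr /= mulrDr [in RHS](mulrC (qint m) 'X^_)%R.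
Qed.

Lemma qint_rev m : (\sum_(a < m) 'X^(m.-1 - a) = qint m)%R.
Proof.
rewrite (reindex_inj rev_ord_inj) /=; apply: eq_bigr => i _; congr ('X^_)%R.
have := ltn_ord i; lia.
Qed.

(** * Inversions and Lehmer codes *)

Definition smaller_before n (s : 'S_n) (j : 'I_n) : nat :=
  #|[set i : 'I_n | (i < j) && (s i < s j)]|.

Lemma card_pairs_snd n (P : rel 'I_n) :
  #|[set p : 'I_n * 'I_n | P p.1 p.2]| = \sum_(j < n) #|[set i | P i j]|.
Proof.
rewrite -sum1dep_card big_mkcond /=.
rewrite -(pair_bigA _ (fun i j => if P i j then 1 else 0)) exchange_big /=.
by apply: eq_bigr => j _; rewrite -sum1dep_card [RHS]big_mkcond.
Qed.

Lemma card_ord_ltn n (v : nat) : v <= n -> #|[set i : 'I_n | i < v]| = v.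
Proof.
move=> le_vn; rewrite -sum1dep_card.
by rewrite -(big_ord_widen n (fun=> 1) le_vn) sum1_card card_ord.
Qed.

(** Since [s] is injective, an entry before position [j] that is not smaller is larger. *)
Lemma inv_smaller_before n (s : 'S_n) :
  Defs.inv s = \sum_(j < n) (j - smaller_before s j).
Proof.
rewrite /Defs.inv (card_pairs_snd (fun i j => (i < j) && (s i > s j))).
apply: eq_bigr => j _.
rewrite -[X in X - _](card_ord_ltn (ltnW (ltn_ord j))).
rewrite -(cardsID [set i | s i < s j] [set i : 'I_n | i < j]).
have -> : [set i : 'I_n | i < j] :&: [set i | s i < s j]
          = [set i : 'I_n | (i < j) && (s i < s j)] by apply/setP=> i; rewrite !inE.
rewrite addKn; apply: eq_card => i; rewrite !inE -leqNgt [RHS]andbC.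
case: (ltnP i j) => //= lt_ij.
rewrite [RHS]leq_eqVlt; case: eqP => // /val_inj/perm_inj eq_ji.
by rewrite eq_ji ltnn in lt_ij.
Qed.

(** Splitting off the last value [v] and standardizing the rest to [s] drives the induction on [n].
    Injectivity suffices because (n + 1) n! = (n + 1)!. *)
Lemma lift_perm_max_bij n :
  bijective (fun p : 'I_n.+1 * 'S_n => lift_perm ord_max p.1 p.2).
Proof.
apply: inj_card_bij => [[v s] [w t] /= eq_vs_wt|]; last first.
  by rewrite card_prod !card_Sn card_ord factS.
have eq_vw : v = w by rewrite -(lift_perm_id ord_max v s) eq_vs_wt lift_perm_id.
rewrite -{}eq_vw in eq_vs_wt *; congr pair; apply/permP=> k.
by apply: (@lift_inj _ v); rewrite -!(lift_perm_lift ord_max) eq_vs_wt.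
Qed.

Lemma ltn_bump v i j : (bump v i < bump v j) = (i < j).
Proof. by rewrite !ltnNge leq_bump2. Qed.

Lemma lift_max_widen n (i : 'I_n) :
  lift ord_max i = widen_ord (leqnSn n) i.
Proof. exact/val_inj/lift_max. Qed.

(** Raising the values from [v] on keeps their relative order, and the last position precedes no
    other. *)
Lemma smaller_before_lift n v (s : 'S_n) (j : 'I_n) :
  smaller_before (lift_perm ord_max v s) (lift ord_max j) = smaller_before s j.
Proof.
rewrite /smaller_before -!sum1dep_card big_mkcond [RHS]big_mkcond big_ord_recr /=.
have -> : bump n j = j by apply: lift_max.
rewrite [n < j]ltnNge (ltnW (ltn_ord j)) /= addn0.
apply: eq_bigr => i _; rewrite -lift_max_widen !lift_perm_lift /=.
by rewrite ltn_bump.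
Qed.

(** The last position holds [v], so every value below [v] sits before it; positions are counted
    through their values. *)
Lemma smaller_before_max n v (s : 'S_n) :
  smaller_before (lift_perm ord_max v s) ord_max = v.
Proof.
rewrite /smaller_before lift_perm_id.
rewrite -[RHS](card_ord_ltn (ltnW (ltn_ord v))).
rewrite -[LHS](card_imset _ (@perm_inj _ (lift_perm ord_max v s))).
apply: eq_card => i; rewrite !inE; apply/imsetP/idP => [[k]|lt_iv].
  by rewrite inE => /andP[_ lt_kv] ->.
exists ((lift_perm ord_max v s)^-1 i)%g; last by rewrite permKV.
rewrite inE permKV lt_iv andbT /= ltn_neqAle -ltnS ltn_ord andbT.
apply: contraTneq lt_iv => eq_n.
have eq_max : ((lift_perm ord_max v s)^-1 i)%g = ord_max by apply: val_inj.
by rewrite -(permKV (lift_perm ord_max v s) i) eq_max lift_perm_id ltnn.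
Qed.

(* The numbers [smaller_before s j] form a Lehmer code of [s]. *)
Lemma sum_prod_smaller_before (R : comNzSemiRingType) (W : nat -> nat -> R) n :
  (\sum_(s : 'S_n) \prod_(j < n) W j (smaller_before s j)
   = \prod_(j < n) \sum_(a < j.+1) W j a)%R.
Proof.
elim: n => [|n IHn].
  rewrite big_ord0 (eq_bigr (fun=> 1%R)) => [|s _]; last by rewrite big_ord0.
  by rewrite sumr_const card_Sn.
rewrite (reindex _ (onW_bij _ (@lift_perm_max_bij n))) /= big_ord_recr /= -IHn.
rewrite -(pair_bigA _ (fun v s => \prod_(j < n.+1)
            W j (smaller_before (lift_perm ord_max v s) j)))%R /=.
rewrite exchange_big mulr_suml; apply: eq_bigr => s _ /=.
rewrite mulr_sumr; apply: eq_bigr => v _.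
rewrite big_ord_recr /= smaller_before_max; congr (_ * _)%R.
apply: eq_bigr => j _; by rewrite -lift_max_widen smaller_before_lift.
Qed.

Lemma inv_genfun n :
  (\sum_(s : 'S_n) 'X^(Defs.inv s) = \prod_(j < n) qint j.+1)%R.
Proof.
transitivity (\sum_(s : 'S_n)
    \prod_(j < n) ('X^(j - smaller_before s j) : {poly nat}))%R.
  by apply: eq_bigr => s _; rewrite prodrXr inv_smaller_before.
rewrite (@sum_prod_smaller_before _ (fun j a => 'X^(j - a)%N)%R).
by apply: eq_bigr => j _; rewrite -(qint_rev j.+1).
Qed.

(** * Colored inversions *)

Definition color_exponent c a (b : nat) : nat := b + c * ((b != 0) * a).

Lemma inv_c_smaller_before c n (sigma : colored_perm c n) :
  inv_c sigma = \sum_(j < n) (j - smaller_before sigma.1 j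
    + color_exponent c (smaller_before sigma.1 j) (sigma.2 j)).
Proof.
rewrite /inv_c /col inv_smaller_before.
rewrite (card_pairs_snd (fun i j => [&& i < j, sigma.1 i < sigma.1 j
                                      & sigma.2 j != 0 :> nat])).
rewrite big_distrr /= -!big_split /=; apply: eq_bigr => j _.
rewrite /color_exponent addnA; congr (_ + c * _).
case: (_ != _ :> nat); rewrite ?mul1n ?mul0n.
  by apply: eq_card => i; rewrite !inE andbT.
by apply: eq_card0 => i; rewrite !inE !andbF.
Qed.

(* The uncolored choices give the exponents below m, and the colored ones give
   each exponent from m to c * m - 1 once. *)
Lemma sum_color_exponent c m : 0 < c ->
  (\sum_(a < m) 'X^(m.-1 - a) * \sum_(b < c) 'X^(color_exponent c a b)
   = qint (m * c))%R.
Proof.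
case: c => // d _.
(* With c = d + 1, color 0 gives the exponent m - 1 - a, and color b + 1 gives m - 1 - a + (b + 1) +
   (d + 1) a = m + d a + b. *)
transitivity (\sum_(a < m) ('X^(m.-1 - a)
                + 'X^m * ('X^(d * a) * qint d)))%R.
  apply: eq_bigr => a _; rewrite big_ord_recl /color_exponent /= mul0n muln0.
  rewrite expr0 mulrDr mulr1; congr (_ + _)%R.
  rewrite /qint !mulr_sumr; apply: eq_bigr => b _; rewrite -!exprD.
  congr ('X^_)%R; rewrite /bump /=; have := ltn_ord a; lia.
rewrite big_split /= qint_rev -mulr_sumr -mulr_suml.
by rewrite mulnS qintD (mulnC m) qintM (mulrC (qint d)).
Qed.

(** For a fixed permutation the colors are chosen independently, so the sum over color functions
    factors into the weights [W], which depend only on the Lehmer code. *)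
Lemma inv_c_genfun c n : 0 < c ->
  (\sum_(sigma : colored_perm c n) 'X^(inv_c sigma)
   = \prod_(j < n) qint (j.+1 * c))%R.
Proof.
move=> c_gt0.
pose W j a : {poly nat} :=
  ('X^(j - a)%N * \sum_(b < c) 'X^(color_exponent c a b))%R.
transitivity (\sum_(s : 'S_n) \prod_(j < n) W j (smaller_before s j))%R.
  rewrite -(pair_bigA _ (fun s f => 'X^(@inv_c c n (s, f))))%R /=.
  apply: eq_bigr => s _; rewrite big_split /= bigA_distr_bigA mulr_sumr.
  apply: eq_bigr => f _; rewrite -big_split inv_c_smaller_before -prodrXr /=.
  by apply: eq_bigr => j _; rewrite exprD.
rewrite sum_prod_smaller_before.
by apply: eq_bigr => j _; rewrite -(sum_color_exponent _ c_gt0).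
Qed.

(** * Partitions through their multiplicities *)

Lemma sum_parts n (F : nat -> nat) l : all (leq 1) l -> all (geq n) l ->
  \sum_(x <- l) F x = \sum_(i < n) F i.+1 * count_mem i.+1 l.
Proof.
elim: l => [|x l IHl] /=.
  by rewrite big_nil big1 // => i; rewrite muln0.
case/andP=> x_gt0 /IHl{}IHl /andP[le_xn /IHl{}IHl].
under [RHS]eq_bigr do rewrite mulnDr.
rewrite big_cons IHl big_split /=; congr (_ + _).
have lt_xn : x.-1 < n by rewrite prednK.
rewrite (bigD1 (Ordinal lt_xn)) //= prednK // eqxx muln1 big1 ?addn0 // => i.
by rewrite -val_eqE /= => ne_ix; case: eqP => [eq_x|]; rewrite ?muln0 //; lia.
Qed.

(** The inverse of the multiplicity map; index [i] stands for the part i + 1. *)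
Definition parts_of_mult n (f : 'I_n -> nat) : seq nat :=
  sort geq (flatten [seq nseq (f i) i.+1 | i <- enum 'I_n]).

Lemma mem_parts_of_mult n (f : 'I_n -> nat) x :
  x \in parts_of_mult f -> 0 < x <= n.
Proof.
rewrite mem_sort => /flatten_mapP[i _]; rewrite mem_nseq => /andP[_ /eqP->].
exact: ltn_ord.
Qed.

Lemma count_parts_of_mult n (f : 'I_n -> nat) i :
  count_mem i.+1 (parts_of_mult f) = \sum_(j < n | j == i :> nat) f j.
Proof.
rewrite count_sort count_flatten -map_comp sumnE big_map big_enum [RHS]big_mkcond /=.
apply: eq_bigr => j _; rewrite count_nseq /= eqSS.
by case: eqP; rewrite ?mul1n ?mul0n.
Qed.

Lemma count_ord_parts_of_mult n (f : 'I_n -> nat) (i : 'I_n) :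
  count_mem i.+1 (parts_of_mult f) = f i.
Proof. by rewrite count_parts_of_mult (big_pred1 i). Qed.

Lemma restricted_partitions_mult n d m :
  restricted_partitions n d m
  = #|[set f : {ffun 'I_n -> 'I_d.+1} | \sum_(i < n) i.+1 * f i == m]|.
Proof.
(* On [A] the counts are at most [d], so [inord] never falls back to its default. *)
pose mult (s : m.-bseq 'I_m.+1) : {ffun 'I_n -> 'I_d.+1} :=
  [ffun i : 'I_n => inord (count_mem i.+1 (map val s))].
rewrite /restricted_partitions; set A := [set s | _].
have AP s : s \in A -> [/\ is_partition m (map val s),
    all (geq n) (map val s) & forall x, count_mem x (map val s) <= d].
  rewrite inE => /and3P[ps le_s /allP ds]; split=> // x.
  have [/ds //|x_s] := boolP (x \in map val s).
  by rewrite (count_memPn x_s).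
have multE s i : s \in A -> mult s i = count_mem i.+1 (map val s) :> nat.
  by move=> /AP[_ _ ds]; rewrite ffunE inordK ?ltnS ?ds.
have mult_inj : {in A &, injective mult}.
  move=> s t As At eq_st; apply/val_inj/(inj_map val_inj) => /=.
  have [/and3P[sorted_s s_gt0 _] le_s _] := AP s As.
  have [/and3P[sorted_t t_gt0 _] le_t _] := AP t At.
  apply: (@sorted_eq _ geq) => //.
  - by move=> y x z /= le_yx le_zy; apply: leq_trans le_zy le_yx.
  - by move=> x y /=; rewrite andbC; apply: anti_leq.
  (* [sum_parts] for the indicator of [P] recovers every count from the multiplicities. *)
  apply/seq.permP=> P; rewrite -!sum1_count !(big_mkcond P) !(@sum_parts n) //=.
  apply: eq_bigr => i _.
  by rewrite -!multE ?eq_st.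
rewrite -(card_in_imset mult_inj); apply: eq_card => f; rewrite !inE.
apply/imsetP/eqP => [[s As ->]|sum_f].
  have [/and3P[_ s_gt0 /eqP sum_s] le_s _] := AP s As.
  rewrite -[RHS]sum_s sumnE (sum_parts id s_gt0 le_s).
  by apply: eq_bigr => i _; rewrite multE.
(* Surjectivity: the list with multiplicities [f] is a preimage. *)
pose l := parts_of_mult (fun i => f i : nat).
have l_gt0 : all (leq 1) l by apply/allP=> x /mem_parts_of_mult /andP[].
have le_l : all (geq n) l by apply/allP=> x /mem_parts_of_mult /andP[].
have pl : is_partition m l.
  apply/and3P; split=> //.
    by apply: sort_sorted => x y /=; apply: leq_total.
  rewrite sumnE (sum_parts id l_gt0 le_l) -sum_f; apply/eqP.
  by apply: eq_bigr => i _; rewrite count_ord_parts_of_mult.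
have [s sl] := partition_bseq pl.
have As : s \in A.
  rewrite inE sl; apply/and3P; split=> //; apply/allP=> -[|x] lx.
    by have := mem_parts_of_mult lx.
  have /= lt_xn := mem_parts_of_mult lx.
  by rewrite (count_ord_parts_of_mult _ (Ordinal lt_xn)) -ltnS.
exists s => //; apply/ffunP=> i; apply: val_inj; rewrite /= multE // sl.
by rewrite count_ord_parts_of_mult.
Qed.

(** Expanding the product chooses a multiplicity [b] for each part size i + 1. *)
Lemma restricted_partitions_genfun n d m :
  ((\prod_(i < n) \sum_(b < d.+1) 'X^(i.+1 * b) : {poly nat})%R`_m)%R
  = restricted_partitions n d m.
Proof.
rewrite bigA_distr_bigA restricted_partitions_mult -coef_sum_Xn.
by congr ((polyseq _)`_m)%R; apply: eq_bigr => f _; rewrite prodrXr.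
Qed.

Theorem theorem3p5 (n c : nat) (hn : 1 <= n) (hc : 1 <= c)
    (k : nat) (hk : k <= (c - 1) * n + c * 'C(n, 2)) :
  colored_mahonian c n k
  = \sum_(0 <= j < k.+1) mahonian n j * restricted_partitions n (c - 1) (k - j).
Proof.
rewrite /colored_mahonian -coef_sum_Xn inv_c_genfun //.
(* Each factor splits into a q-integer, for the inversions, and a factor for the parts of size j +
   1; the coefficient of the product is then a convolution. *)
rewrite (eq_bigr _ (fun (j : 'I_n) _ => qintM j.+1 c)) big_split /= -inv_genfun.
rewrite coefM big_mkord; apply: eq_bigr => j _.
rewrite coef_sum_Xn; case: c hc {hk} => // d _.
by rewrite subn1 restricted_partitions_genfun.
Qed.
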